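(* Let $b\in\mathbb{R}$, let $1<\alpha<2$, and let ${f:{}_{b+1}\mathbb{N}\to\mathbb{R}}$ be a function such that ${}_{b+1}\nabla^{\alpha}f(u)\ge 0$ for all $u\in{}_{b}\mathbb{N}$. Then $-\Delta f(t)\ge 0$ for all $t\in{}_{b-1}\mathbb{N}$.
   Context: For a real number $c$, ${}_{c}\mathbb{N}=\{c,c-1,c-2,\dots\}$. $\Delta f(t)=f(t+1)-f(t)$, $\Delta^m=\Delta(\Delta^{m-1})$, $\rho(t)=t-1$. The rising function is $x^{\overline{\beta}}=\Gamma(x+\beta)/\Gamma(x)$. The nabla right fractional sum of order $\beta>0$ ending at $c$ is ${}_{c}\nabla^{-\beta}f(t)=\frac{1}{\Gamma(\beta)}\sum_{s=t}^{c-1}(s-\rho(t))^{\overline{\beta-1}}f(s)$, with empty sums equal to $0$. For noninteger $\alpha>0$ and $n=[\alpha]+1$ (here $n=2$) the nabla right (Riemann) fractional difference is ${}_{c}\nabla^{\alpha}f(t)=(-1)^n\Delta^n\,{}_{c}\nabla^{-(n-\alpha)}f(t)$, $t\in{}_{c-1}\mathbb{N}$; equivalently, ${}_{c}\nabla^{\alpha}f(t)=\frac{1}{\Gamma(-\alpha)}\sum_{s=t}^{c-1}(s-\rho(t))^{\overline{-\alpha-1}}f(s)$. Here it is used with $c=b+1$. *)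

(* Defs.v *)
From mathcomp Require Import all_boot all_order all_algebra.
From mathcomp Require Import all_classical all_reals all_analysis.

Set Implicit Arguments.
Unset Strict Implicit.
Unset Printing Implicit Defensive.

Import Order.TTheory GRing.Theory Num.Theory.

Local Open Scope classical_set_scope.
Local Open Scope ring_scope.

(* {c, c - 1, c - 2, ...} *)
Definition down_from (R : realType) (c : R) : set R :=
  [set t | exists k : nat, t = c - k%:R].

Definition delta (R : realType) (f : R -> R) : R -> R :=
  fun t => f (t + 1) - f t.

Definition rho (R : realType) (t : R) : R := t - 1.

Definition Euler_integral (R : realType) (x : R) : R :=
  \int[@lebesgue_measure R]_(u in `]0, +oo[) (u `^ (x - 1) * expR (- u)).

(* For x > 0 we have m = 0 and this is the Euler integral; for x <= 0, m is
   the integer with 0 < x + m <= 1 and the value comes from m uses of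
   Gamma(x + 1) = x Gamma(x). At the poles 0, -1, -2, ... the product vanishes,
   so the value is 0. *)
Definition Gamma (R : realType) (x : R) : R :=
  let m := Num.truncn (1 - x) in
  Euler_integral (x + m%:R) / \prod_(i < m) (x + i%:R).

Definition rising (R : realType) (x beta : R) : R :=
  Gamma (x + beta) / Gamma x.

(* For t in the lattice c + Z, truncn (c - t) is the number of
   s = t, t + 1, ..., c - 1, which is 0 as soon as c <= t. *)
Definition nabla_right_sum (R : realType) (c beta : R) (f : R -> R) : R -> R :=
  fun t => (Gamma beta)^-1 *
    \sum_(k < Num.truncn (c - t))
      let s := t + k%:R in rising (s - rho t) (beta - 1) * f s.

(* Riemann difference, meant for noninteger alpha > 0. *)
Definition nabla_right_diff (R : realType) (c alpha : R) (f : R -> R) : R -> R :=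
  let n := (Num.truncn alpha).+1 in
  fun t => (-1) ^+ n *
    iter n (@delta R) (nabla_right_sum c (n%:R - alpha) f) t.

(* Main.v *)
(* Put beta = 2 - alpha in (0, 1), a_k = f(b - k), and let d be the sequence of
   first differences of a (d_0 = a_0). On the lattice the fractional sum is the
   convolution of a with w_j = Gamma(j + beta) / (Gamma(j + 1) Gamma(beta)), so
   the hypothesis says that w * d is nondecreasing and starts nonnegatively:
   w_0 d_k - \sum_(j < k) (w_j - w_(j+1)) d_(k-1-j) >= 0. Since
   w_(j+1) / w_j = (j + beta) / (j + 1) <= 1, the weights w_j - w_(j+1) are
   nonnegative and strong induction gives d >= 0. *)
Require Import Defs.
From mathcomp Require Import all_boot all_order all_algebra.
From mathcomp Require Import all_classical all_reals all_analysis.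
From mathcomp Require Import measurable_realfun ring lra.

Import Order.TTheory GRing.Theory Num.Theory.
Import numFieldNormedType.Exports.

Local Open Scope classical_set_scope.
Local Open Scope ring_scope.

(** * Positivity of differences under a convolution with decreasing weights *)

Lemma convolution_diff_nonneg (R : realDomainType) (w a : nat -> R)
    (S := fun k => \sum_(j < k) w j * a (k.-1 - j)%N) :
  0 < w 0%N -> (forall j, w j.+1 <= w j) ->
  (forall k, 0 <= S k.+1 - S k *+ 2 + S k.-1) ->
  forall k, 0 <= a k.+1 - a k.
Proof.
move=> w0 wdec Sconv.
(* Extending [a] by zero below index 0 makes [a 0] a difference too, so the induction also carries
   [0 <= a 0]. *)
pose d i := if i is i'.+1 then a i'.+1 - a i' else a 0%N.
suff dge0 : forall k, 0 <= d k by move=> k; exact: (dge0 k.+1).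
have SB k : S k.+1 - S k = \sum_(j < k.+1) w j * d (k - j)%N.
  rewrite /S !big_ord_recr /= subnn addrAC -sumrB; congr (_ + _).
  apply: eq_bigr => j _.
  have -> : (k - j = (k.-1 - j).+1)%N.
    by rewrite -subn1 subnAC subn1 prednK// subn_gt0.
  by rewrite /= mulrBr.
(* The [j = 0] term of the upper sum is split off; the term [j.+1] then pairs with the term [j] of
   the lower sum, both having the factor [d (k - j)]. *)
have SS k : S k.+2 - S k.+1 *+ 2 + S k =
    w 0%N * d k.+1 - \sum_(j < k.+1) (w j - w j.+1) * d (k - j)%N.
  rewrite -[LHS](_ : (S k.+2 - S k.+1) - (S k.+1 - S k) = _); last by ring.
  rewrite !SB.
  rewrite big_ord_recl subn0 -addrA -sumrB -sumrN; congr (_ + _).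
  apply: eq_bigr => j _; rewrite /= /bump /= add1n subSS; ring.
elim/ltn_ind => -[_|k IH].
  (* Since [0.-1 = 0], the hypothesis at 0 involves only empty sums besides [S 1], and reads
     [0 <= w 0 * a 0]. *)
  have := Sconv 0%N; rewrite /S big_ord1 big_ord0 mul0rn subr0 addr0 /=.
  by rewrite pmulr_rge0.
rewrite -(pmulr_rge0 _ w0).
have := Sconv k.+1; rewrite SS subr_ge0; apply: le_trans.
apply: sumr_ge0 => j _; rewrite mulr_ge0 ?subr_ge0//.
by apply: IH; rewrite ltnS leq_subr.
Qed.

(** * Euler's integral: functional equation, finiteness and positivity *)

Section gamma_integral.
Context {R : realType}.
Notation mu := (@lebesgue_measure R).
Implicit Types x a b u : R.

Definition gamma_integrand x u := u `^ (x - 1) * expR (- u).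

Definition gamma_eint x :=
  (\int[mu]_(u in `]0%R, +oo[) (gamma_integrand x u)%:E)%E.

Lemma gamma_integrand_ge0 x u : 0 <= gamma_integrand x u.
Proof. by rewrite mulr_ge0 ?powR_ge0 ?expR_ge0. Qed.

Lemma measurable_gamma_integrand x (D : set R) :
  measurable_fun D (EFin \o gamma_integrand x).
Proof.
apply/measurable_EFinP/measurable_funTS; apply: measurable_funM.
  exact: measurable_powR.
by apply: measurableT_comp; [exact: measurable_expR|exact: oppr_measurable].
Qed.

Lemma is_derive_expRN u :
  is_derive u 1 (fun u => - expR (- u) : R) (expR (- u)).
Proof. by apply: is_derive_eq; rewrite mulrN1 opprK. Qed.

Lemma gamma_integrand_parts x a b : 0 < x -> 0 < a -> a < b ->
  (\int[mu]_(u in `[a, b]) (gamma_integrand (x + 1) u)%:E =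
   (a `^ x * expR (- a) - b `^ x * expR (- b))%:E
   + x%:E * \int[mu]_(u in `[a, b]) (gamma_integrand x u)%:E)%E.
Proof.
move=> x0 a0 ab.
have pos u : a <= u -> 0 < u by exact: lt_le_trans.
have cpow r : {within `[a, b], continuous (@powR R ^~ r)}.
  apply: derivable_within_continuous => u; rewrite in_itv/= => /andP[au _].
  by apply: derivable_powR; rewrite in_itv/= pos.
have cexp : continuous (fun u : R => expR (- u)).
  move=> u; apply: continuous_comp; first exact: opp_continuous.
  exact: continuous_expR.
have LR (F : R -> R) : (forall u, a <= u -> derivable F u 1) ->
    derivable_oo_LRcontinuous F a b.
  move=> dF.
  have cF u : a <= u -> {for u, continuous F}.
    by move=> au; apply/differentiable_continuous/derivable1_diffP/dF.
  split.
  - by move=> u; rewrite in_itv/= => /andP[/ltW au _]; exact: dF.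
  - exact/cvg_at_right_filter/cF.
  - exact/cvg_at_left_filter/cF/ltW.
have := @integration_by_parts R (@powR R ^~ x) (fun u => - expR (- u))
  (fun u => x * u `^ (x - 1)) (fun u => expR (- u)) a b ab.
have -> : (\int[mu]_(u in `[a, b]) (x * u `^ (x - 1) * - expR (- u))%:E =
    - (x%:E * \int[mu]_(u in `[a, b]) (gamma_integrand x u)%:E))%E.
  rewrite -(@ge0_integralZl_EFin _ _ R mu _ _ (EFin \o gamma_integrand x))//;
    first last.
  - exact: ltW.
  - exact: measurable_gamma_integrand.
  - by move=> u _; rewrite lee_fin gamma_integrand_ge0.
  rewrite -integral_ge0N; last first.
    by move=> u _; rewrite lee_fin mulr_ge0 ?gamma_integrand_ge0 ?ltW.
  by apply: eq_integral => u _; rewrite mulrN -mulrA.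
rewrite oppeK.
under [X in _ -> X = _]eq_integral do rewrite /gamma_integrand addrK.
move=> ->.
- by congr (_%:E + _)%E; rewrite !mulrN opprK addrC.
- move=> u; apply: cvgM; [exact: cvg_cst|exact: cpow].
- by apply: LR => u au; apply: derivable_powR; rewrite in_itv/= pos.
- move=> u; rewrite in_itv/= => /andP[au _].
  by rewrite powR_derive1// in_itv/= (pos _ (ltW au)).
- exact: continuous_subspaceT.
- by apply: LR => u _; exact: (@ex_derive _ _ _ _ _ _ _ (is_derive_expRN u)).
- move=> u _; rewrite derive1E.
  exact: (@derive_val _ _ _ _ _ _ _ (is_derive_expRN u)).
Qed.

(** For [1 <= u] and [x <= k], the power is at most [u ^+ k], while [expR u] dominates
    [u ^+ k.+1 / k.+1!]; the quotient is at most [k.+1! / u]. *)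
Lemma powRM_expRN_cvg0y x : (u `^ x * expR (- u)) @[u --> +oo] --> (0 : R).
Proof.
pose k := (Num.truncn x).+1.
have xk : x <= k%:R by apply/ltW/truncnS_gt.
apply: (@squeeze_cvgr _ _ _ _ (fun=> 0) (fun u => k.+1`!%:R * u^-1)).
- near=> u.
  have u1 : 1 <= u by near: u; exact: nbhs_pinfty_ge.
  have u0 : 0 < u by exact: lt_le_trans u1.
  rewrite mulr_ge0 ?powR_ge0 ?expR_ge0//=.
  rewrite expRN ler_pdivrMr ?expR_gt0//.
  apply: (@le_trans _ _ (u ^+ k)).
    by rewrite -powR_mulrn ?(ltW u0)// ler_powR.
  rewrite -mulrA -ler_pdivrMl ?ltr0n ?fact_gt0// ler_pdivlMl// mulrCA -exprS.
  rewrite mulrC.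
  by apply: le_trans (expR_ge1Dxn k (ltW u0)); rewrite lerDr.
- exact: cvg_cst.
- rewrite -[X in _ --> X](mulr0 (k.+1`!%:R)); apply: cvgMl_tmp.
  apply/gtr0_cvgV0; last exact: cvg_id.
  exact: nbhs_pinfty_gt.
Unshelve. all: by end_near. Qed.

Lemma powRM_expRN_cvg0 x : 0 < x ->
  (u `^ x * expR (- u)) @[u --> 0^'+] --> (0 : R).
Proof.
move=> x0; rewrite -[X in _ --> X](mul0r (expR (- 0))).
apply: cvgM; first exact: powR_cvg0.
apply/cvg_at_right_filter; apply: continuous_comp; first exact: opp_continuous.
exact: continuous_expR.
Qed.

(** Compact exhaustion of the half-line. The shift by 2 keeps the endpoints distinct even for
    [n = 0], as integration by parts requires. *)
Let trunc_itv n : set R := `[n.+2%:R^-1, n.+2%:R].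

Lemma gamma_eint_cvg x :
  (\int[mu]_(u in trunc_itv n) (gamma_integrand x u)%:E)%E @[n --> \oo]
    --> gamma_eint x.
Proof.
rewrite /gamma_eint.
have -> : `]0%R, +oo[%classic = \bigcup_n trunc_itv n.
  rewrite eqEsubset; split => u /=; rewrite in_itv/= ?andbT => u0.
    (* An integer above [u + u^-1] bounds both [u] and [u^-1], hence handles both endpoints at
       once. *)
    exists (Num.truncn (u + u^-1)) => //; rewrite /trunc_itv /= in_itv/=.
    have uv : u + u^-1 <= (Num.truncn (u + u^-1)).+2%:R.
      by apply: (le_trans (ltW (truncnS_gt _))); rewrite ler_nat.
    apply/andP; split.
      rewrite invf_ple ?posrE// (le_trans _ uv)// lerDr ltW//.
    by rewrite (le_trans _ uv)// lerDl invr_ge0 ltW.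
  case: u0 => n _; rewrite /trunc_itv /= in_itv/= => /andP[+ _].
  exact: lt_le_trans.
apply: ge0_nondecreasing_set_cvg_integral.
- move=> n m nm; apply/subsetPset/subset_itv; rewrite bnd_simp.
    by rewrite lef_pV2 ?posrE ?ltr0n// ler_nat.
  by rewrite ler_nat.
- by move=> n; exact: measurable_itv.
- by move=> n; exact: measurable_gamma_integrand.
- by move=> n u _; rewrite lee_fin gamma_integrand_ge0.
Qed.

(** Limit of the integration by parts over [trunc_itv n], whose boundary terms vanish. The identity
    lives in the extended reals because finiteness is deduced from it afterwards. *)
Lemma gamma_eintS x : 0 < x -> gamma_eint (x + 1) = (x%:E * gamma_eint x)%E.
Proof.
move=> x0; apply: (cvg_unique (@ereal_hausdorff R) (gamma_eint_cvg (x + 1))).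
pose h u := u `^ x * expR (- u).
have hN : (h n.+2%:R^-1 - h n.+2%:R) @[n --> \oo] --> 0.
  rewrite -[X in _ --> X](subr0 0); apply: cvgB.
    have /cvg_at_rightP := powRM_expRN_cvg0 x x0; apply; split => [n|].
      by rewrite invr_gt0.
    by have := @cvg_harmonic R; rewrite -cvg_shiftS.
  apply: (cvg_comp (fun n => n.+2%:R) h); last exact: powRM_expRN_cvg0y.
  under eq_fun do rewrite -addn2.
  exact: (cvg_comp (addn^~ 2%N) (fun n => n%:R : R) (cvg_addnr 2) cvgr_idn).
have -> : (fun n =>
    \int[mu]_(u in trunc_itv n) (gamma_integrand (x + 1) u)%:E)%E =
  (fun n => (h n.+2%:R^-1 - h n.+2%:R)%:E +
     x%:E * \int[mu]_(u in trunc_itv n) (gamma_integrand x u)%:E)%E.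
  apply/funext => n; apply: gamma_integrand_parts => //.
    by rewrite (@lt_trans _ _ 1) ?invf_lt1 ?ltr1n.
rewrite /= -[X in _ --> X]add0e; apply: cvgeD => //.
  by apply: cvg_EFin; [exact: nearW|exact: hN].
by apply: cvgeZl => //; exact: gamma_eint_cvg.
Qed.

Lemma gamma_eint_ge0 x : (0 <= gamma_eint x)%E.
Proof. by apply: integral_ge0 => u _; rewrite lee_fin gamma_integrand_ge0. Qed.

Lemma gamma_eint_natS_lty n : (gamma_eint n.+1%:R < +oo)%E.
Proof.
elim: n => [|n IH]; last first.
  by rewrite -[n.+2]addn1 natrD gamma_eintS// lte_mul_pinfty ?lee_fin.
(* At 1 the integrand is the density of the exponential law of rate 1. *)
have /integrableP[_] :
    mu.-integrable `]0, +oo[ (EFin \o exponential_pdf (1 : R)).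
  by apply: integrableS (integrable_exponential_pdf ltr01).
apply: le_lt_trans; rewrite /gamma_eint le_eqVlt; apply/orP; left; apply/eqP.
apply: eq_integral => u; rewrite inE/= in_itv/= andbT => u0.
rewrite ger0_norm ?exponential_pdf_ge0// exponential_pdfE ?ltW//.
by rewrite /gamma_integrand subrr powRr0 mulN1r.
Qed.

Lemma gamma_eint_lty x : 0 < x -> (gamma_eint x < +oo)%E.
Proof.
move=> x0.
(* By the functional equation an infinite value at [x] would persist at [x + 1], where the exponent
   of [u] is positive and the integrand is bounded near 0. *)
suff : (gamma_eint (x + 1) < +oo)%E.
  rewrite gamma_eintS//; move: (gamma_eint_ge0 x).
  by case: (gamma_eint x) => [r|//|//] _; rewrite ?ltry// gt0_muley ?lte_fin.
(* Finiteness at integers suffices, as u^x <= 1 + u^n for x <= n. *)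
pose n := (Num.truncn x).+1.
have xn : x <= n%:R by apply/ltW/truncnS_gt.
apply: (@le_lt_trans _ _ (gamma_eint 1 + gamma_eint n.+1%:R)%E); last first.
  apply: lte_add_pinfty; last exact: gamma_eint_natS_lty.
  by have := gamma_eint_natS_lty 0; rewrite mulr1n.
rewrite /gamma_eint -ge0_integralD//; first last.
- exact: measurable_gamma_integrand.
- by move=> u _; rewrite lee_fin gamma_integrand_ge0.
- exact: measurable_gamma_integrand.
- by move=> u _; rewrite lee_fin gamma_integrand_ge0.
apply: ge0_le_integral => //.
- by move=> u _; rewrite lee_fin gamma_integrand_ge0.
- exact: measurable_gamma_integrand.
- by apply: emeasurable_funD; exact: measurable_gamma_integrand.
move=> u; rewrite /= in_itv/= andbT => u0.
rewrite -EFinD lee_fin /gamma_integrand -mulrDl ler_wpM2r ?expR_ge0//.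
rewrite subrr powRr0 addrK -natr1 addrK.
have [u1|/ltW u1] := leP u 1.
  rewrite ler_wpDr ?powR_ge0//.
  apply: (@le_trans _ _ (1 `^ x)); last by rewrite powR1.
  by apply: ge0_ler_powR; rewrite ?nnegrE ?(ltW u0) ?(ltW x0).
by rewrite ler_wpDl// ler_powR.
Qed.

(** After the shift to [x + 1], the integrand is at least [expR (- 2)] on [[1, 2]]. *)
Lemma gamma_eint_gt0 x : 0 < x -> (0 < gamma_eint x)%E.
Proof.
move=> x0.
suff : (0 < gamma_eint (x + 1))%E by rewrite gamma_eintS// pmule_rgt0 ?lte_fin.
apply: (@lt_le_trans _ _ (\int[mu]_(u in `[1%R, 2%R]) (expR (- 2))%:E)%E).
  rewrite integral_cst//= lebesgue_measure_itv/= lte_fin ltr1n -EFinB -EFinM.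
  by rewrite lte_fin mulr_gt0 ?expR_gt0// subr_gt0 ltr1n.
apply: (@le_trans _ _
  (\int[mu]_(u in `[1%R, 2%R]) (gamma_integrand (x + 1) u)%:E)%E).
  apply: ge0_le_integral => //.
  - exact: measurable_gamma_integrand.
  - move=> u; rewrite /= in_itv/= => /andP[u1 u2].
    rewrite lee_fin /gamma_integrand addrK -[leLHS]mul1r.
    rewrite ler_pM ?expR_ge0 ?ler_expR ?lerN2//.
    by rewrite -[leLHS](powRr0 u) ler_powR// ltW.
apply: ge0_subset_integral => //.
- exact: measurable_gamma_integrand.
- by move=> u _; rewrite lee_fin gamma_integrand_ge0.
- by apply: subset_itv; rewrite bnd_simp.
Qed.

(** The real-valued integral is the [fine] part of the extended one, so finiteness is what makes the
    two agree. *)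
Lemma GammaE x : 0 < x -> (Gamma x)%:E = gamma_eint x.
Proof.
move=> x0; rewrite /Gamma.
have -> : Num.truncn (1 - x) = 0%N.
  by apply/truncn0Pn; rewrite -ltNge ltrBlDr ltrDl.
rewrite big_ord0 divr1 addr0 /Euler_integral /Rintegral fineK//.
by rewrite ge0_fin_numE ?gamma_eint_ge0 ?gamma_eint_lty.
Qed.

Lemma Gamma_gt0 x : 0 < x -> 0 < Gamma x.
Proof. by move=> x0; rewrite -lte_fin GammaE// gamma_eint_gt0. Qed.

Lemma GammaS x : 0 < x -> Gamma (x + 1) = x * Gamma x.
Proof.
move=> x0; apply: EFin_inj.
by rewrite [RHS]EFinM !GammaE ?gamma_eintS// ltr_wpDl// ltW.
Qed.

End gamma_integral.

(** * The fractional sum as a convolution, and the theorem *)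

Lemma nabla_right_sum_down_from (R : realType) (c beta : R) (f : R -> R)
    (k : nat) :
  nabla_right_sum c beta f (c - k%:R) =
  \sum_(j < k) (Gamma (j%:R + beta) / Gamma j.+1%:R / Gamma beta)
     * f (c - 1 - (k.-1 - j)%:R).
Proof.
rewrite /nabla_right_sum opprB addrC subrK natrK mulr_sumr.
apply: eq_bigr => j _; rewrite /rising /rho.
have -> : c - k%:R + j%:R - (c - k%:R - 1) = j.+1%:R by rewrite -natr1; ring.
have -> : j.+1%:R + (beta - 1) = j%:R + beta by rewrite -natr1; ring.
have -> : c - k%:R + j%:R = c - 1 - (k.-1 - j)%:R.
  case: k j => [[]//|k j]; rewrite /= natrB -1?ltnS// -natr1; ring.
by rewrite mulrA [_^-1 * _]mulrC.
Qed.

Theorem theorem4p2 (R : realType) (b alpha : R) (f : R -> R)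
  (halpha : 1 < alpha < 2)
  (hf : forall u : R, down_from b u -> 0 <= nabla_right_diff (b + 1) alpha f u) :
  forall t : R, down_from (b - 1) t -> 0 <= - delta f t.
Proof.
move=> _ [k ->].
have /andP[alpha1 alpha2] := halpha.
pose beta := 2 - alpha.
have beta_gt0 : 0 < beta by rewrite subr_gt0.
have beta_lt1 : beta < 1 by rewrite /beta; lra.
pose w j : R := Gamma (j%:R + beta) / Gamma j.+1%:R / Gamma beta.
have jbeta j : 0 < j%:R + beta by rewrite ltr_wpDl.
have w_gt0 j : 0 < w j.
  by apply: divr_gt0; first apply: divr_gt0; exact: Gamma_gt0.
have w_decr j : w j.+1 <= w j.
  have -> : w j.+1 = (j%:R + beta) / j.+1%:R * w j.
    have numE : Gamma (j.+1%:R + beta) = (j%:R + beta) * Gamma (j%:R + beta).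
      by rewrite -natr1 addrAC GammaS.
    have denE : Gamma (j.+2%:R : R) = j.+1%:R * Gamma j.+1%:R.
      by rewrite -GammaS// natr1.
    rewrite /w numE denE.
    have gj : Gamma (j.+1%:R : R) != 0 by rewrite gt_eqF// Gamma_gt0.
    have gb : Gamma beta != 0 by rewrite gt_eqF// Gamma_gt0.
    have j0 : j.+1%:R != 0 :> R by rewrite pnatr_eq0.
    move: (Gamma (j%:R + beta)) (Gamma j.+1%:R) (Gamma beta) gj gb.
    by move=> p q r q0 r0; move: j0; rewrite -natr1 => j0; field; apply/and3P.
  rewrite ler_piMl ?(ltW (w_gt0 j))// ler_pdivrMr// mul1r -natr1 lerD2l.
  exact: ltW.
have := @convolution_diff_nonneg R w (fun i => f (b - i%:R)) (w_gt0 0%N)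
  w_decr _ k.
have -> : - delta f (b - 1 - k%:R) = f (b - k.+1%:R) - f (b - k%:R).
  rewrite /delta opprB; congr (f _ - f _); rewrite -?natr1; ring.
apply => {}k.
have := hf (b - k%:R) (ex_intro _ k erefl).
rewrite /nabla_right_diff.
(* Hence [n = 2]: the sign is 1 and the inner sum has order [beta]. *)
have -> : Num.truncn alpha = 1%N by apply: truncn_def; rewrite ltW.
rewrite sqrrN expr1n mul1r /= /delta.
(* Counted from [c = b + 1], the point lies [k.+1] steps down, so the second difference involves the
   sums with [k.+1], [k] and [k.-1] terms. *)
have -> : b - k%:R = b + 1 - k.+1%:R by rewrite -natr1; ring.
have -> : b + 1 - k.+1%:R + 1 = b + 1 - k%:R by rewrite -natr1; ring.
rewrite -/beta.
have -> : nabla_right_sum (b + 1) beta f (b + 1 - k%:R + 1) =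
    nabla_right_sum (b + 1) beta f (b + 1 - k.-1%:R).
  (* For k = 0 the left-hand sum would end below its start: both are empty. *)
  case: k => [|k]; last by congr nabla_right_sum; rewrite -natr1 /=; ring.
  rewrite /nabla_right_sum !subr0.
  have -> : b + 1 - (b + 1 + 1) = -1 :> R by ring.
  rewrite subrr truncn0.
  have -> : Num.truncn (-1 : R) = 0%N by apply/truncn0Pn; rewrite -ltNge; lra.
  by rewrite !big_ord0.
rewrite !nabla_right_sum_down_from addrK.
set A := \sum_(j < k.-1) _; set B := \sum_(j < k) _; set C := \sum_(j < k.+1) _.
by rewrite (_ : A - B - _ = C - B *+ 2 + A)//; ring.
Qed.
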